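(* Let $\Delta\subset\mathbb{R}^5$ be a $5$-dimensional Gorenstein simplex of degree $3$ which is not a lattice pyramid. Then $\Delta$ is unimodularly equivalent to one of the following six simplices, each given as the convex hull of the listed vertices, where $\mathbf{0}$ is the origin of $\mathbb{R}^5$ and $\mathbf{e}_1,\dots,\mathbf{e}_5$ are the standard unit coordinate vectors: 1. $\mathbf{0},\ \mathbf{e}_1,\ \mathbf{e}_2,\ \mathbf{e}_3,\ \mathbf{e}_4,\ \mathbf{e}_1+\mathbf{e}_2+\mathbf{e}_3+\mathbf{e}_4+2\mathbf{e}_5$; 2. $\mathbf{0},\ \mathbf{e}_1,\ \mathbf{e}_2,\ \mathbf{e}_3,\ 2\mathbf{e}_4,\ \mathbf{e}_1+\mathbf{e}_2+\mathbf{e}_3+2\mathbf{e}_5$; 3. $\mathbf{0},\ \mathbf{e}_1,\ \mathbf{e}_2,\ 2\mathbf{e}_3,\ 2\mathbf{e}_4,\ \mathbf{e}_1+\mathbf{e}_2+2\mathbf{e}_5$; 4. $\mathbf{0},\ \mathbf{e}_1,\ \mathbf{e}_2,\ 2\mathbf{e}_3,\ \mathbf{e}_2+2\mathbf{e}_4,\ \mathbf{e}_1+2\mathbf{e}_5$; 5. $\mathbf{0},\ \mathbf{e}_1,\ 2\mathbf{e}_2,\ 2\mathbf{e}_3,\ 2\mathbf{e}_4,\ \mathbf{e}_1+2\mathbf{e}_5$; 6. $\mathbf{0},\ 2\mathbf{e}_1,\ 2\mathbf{e}_2,\ 2\mathbf{e}_3,\ 2\mathbf{e}_4,\ 2\m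athbf{e}_5$.
   Context: A lattice polytope is a convex polytope in $\mathbb{R}^d$ all of whose vertices lie in $\mathbb{Z}^d$. Two lattice polytopes $P,Q\subset\mathbb{R}^d$ are unimodularly equivalent if $Q=f_U(P)+\mathbf{w}$ for some $\mathbf{w}\in\mathbb{Z}^d$ and some $U\in\mathbb{Z}^{d\times d}$ with $\det U=\pm1$, where $f_U(\mathbf{x})=\mathbf{x}U$. For a lattice polytope $P\subset\mathbb{R}^{d}$ of dimension $d$, $\mathrm{Pyr}(P)=\mathrm{conv}(P\times\{0\},(0,\dots,0,1))\subset\mathbb{R}^{d+1}$; a lattice polytope is a lattice pyramid if, up to unimodular equivalence, it is obtained by successively applying $\mathrm{Pyr}$ (at least once) to a lower-dimensional lattice polytope. For a $d$-dimensional lattice polytope $P\subset\mathbb{R}^d$, $\mathrm{codeg}(P)=\min\{n\in\mathbb{Z}_{>0}:\mathrm{int}(nP)\cap\mathbb{Z}^d\ne\emptyset\}$ and the degree is $\deg(P)=d+1-\mathrm{codeg}(P)$. A $d$-dimensional lattice polytope $P\subset\mathbb{R}^d$ is reflexive if the origin is in its interior and $P^\vee=\{\mathbf{y}\in\mathbb{R}^d:\langle\mathbf{x},\mathbf{y}\rangle\le1\ \forall\mathbf{x}\in P\}$ is a lattice polytope; $P$ is Gorenstein if $rP$ is unimodularly equivalent to a reflexive polytope for some integer $r\ge1$. A Gorenstein simplex is a lattice simplex that is Gorenstein. *)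

(* Defs.v *)
From HB Require Import structures.
From mathcomp Require Import all_boot all_order all_algebra.
From mathcomp Require Import boolp classical_sets reals topology normedtype convex.

Set Implicit Arguments.
Unset Strict Implicit.
Unset Printing Implicit Defensive.

Import Order.TTheory GRing.Theory Num.Theory.
Import numFieldNormedType.Exports.
Local Open Scope classical_set_scope.
Local Open Scope ring_scope.

Section Polytopes.
Variable R : realType.

(* R^d is the space 'rV[R]_d of row vectors, with its product topology. *)

Definition conv_hull d (A : set 'rV[R]_d) : set 'rV[R]_d :=
  smallest (@convex_set R 'rV[R]_d) A.

Definition affine_set d (A : set 'rV[R]_d) : Prop :=
  forall x y (t : R), A x -> A y -> A (t *: x + (1 - t) *: y).

Definition affine_hull d (A : set 'rV[R]_d) : set 'rV[R]_d :=
  smallest (@affine_set d) A.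

(* P has dimension d, i.e. its affine hull is all of R^d; in particular P is
   nonempty, also when d = 0. *)
Definition full_dim d (P : set 'rV[R]_d) : Prop := affine_hull P = setT.

Definition polytope d (P : set 'rV[R]_d) : Prop :=
  exists s : seq 'rV[R]_d, P = conv_hull [set` s].

(* The vertices of a polytope are its extreme points. *)
Definition vertex d (P : set 'rV[R]_d) (v : 'rV[R]_d) : Prop :=
  P v /\ forall x y (t : R), P x -> P y -> 0 < t -> t < 1 ->
    v = t *: x + (1 - t) *: y -> x = y.

Definition affine_indep d n (v : 'I_n -> 'rV[R]_d) : Prop :=
  forall a : 'I_n -> R, \sum_i a i = 0 -> \sum_i a i *: v i = 0 ->
    forall i, a i = 0.

Definition simplex d (P : set 'rV[R]_d) : Prop :=
  exists (n : nat) (v : 'I_n.+1 -> 'rV[R]_d),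
    affine_indep v /\ P = conv_hull (range v).

(* The lattice Z^d in R^d. *)
Definition Zlattice d : set 'rV[R]_d :=
  range (map_mx intr : 'rV[int]_d -> 'rV[R]_d).

Definition lattice_polytope d (P : set 'rV[R]_d) : Prop :=
  polytope P /\ forall v, vertex P v -> Zlattice v.

Definition unimod_equiv d (P Q : set 'rV[R]_d) : Prop :=
  exists (U : 'M[int]_d) (w : 'rV[int]_d),
    (\det U = 1 \/ \det U = -1) /\
    Q = [set x *m map_mx intr U + map_mx intr w | x in P].

Definition Pyr d (P : set 'rV[R]_d) : set 'rV[R]_(d + 1) :=
  conv_hull ([set row_mx x 0 | x in P] `|` [set row_mx 0 1]).

(* iterated_Pyr Q P means that P = Pyr (... (Pyr Q)), with Pyr applied at least
   once. *)
Inductive iterated_Pyr d0 (Q : set 'rV[R]_d0) :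
    forall d, set 'rV[R]_d -> Prop :=
| iterated_Pyr_once : iterated_Pyr Q (Pyr Q)
| iterated_Pyr_more d (P : set 'rV[R]_d) :
    iterated_Pyr Q P -> iterated_Pyr Q (Pyr P).

Definition lattice_pyramid d (P : set 'rV[R]_d) : Prop :=
  exists (d0 : nat) (Q : set 'rV[R]_d0) (P' : set 'rV[R]_d),
    [/\ lattice_polytope Q, full_dim Q, iterated_Pyr Q P' & unimod_equiv P' P].

Definition dilate d (n : nat) (P : set 'rV[R]_d) : set 'rV[R]_d :=
  [set n%:R *: x | x in P].

Definition is_codeg d (P : set 'rV[R]_d) (n : nat) : Prop :=
  let S := [set m : nat | (0 < m)%N /\
                          interior (dilate m P) `&` @Zlattice d !=set0] in
  S n /\ forall m, S m -> (n <= m)%N.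

(* deg P = d + 1 - codeg P, written additively to avoid truncated
   subtraction. *)
Definition is_deg d (P : set 'rV[R]_d) (s : nat) : Prop :=
  exists c : nat, is_codeg P c /\ (s + c = d + 1)%N.

Definition dual d (P : set 'rV[R]_d) : set 'rV[R]_d :=
  [set y | forall x, P x -> \sum_(i < d) x 0 i * y 0 i <= 1].

Definition reflexive_polytope d (P : set 'rV[R]_d) : Prop :=
  [/\ lattice_polytope P, full_dim P, interior P 0 &
      lattice_polytope (dual P)].

Definition Gorenstein d (P : set 'rV[R]_d) : Prop :=
  [/\ lattice_polytope P, full_dim P &
      exists (r : nat) (Q : set 'rV[R]_d),
        [/\ (1 <= r)%N, reflexive_polytope Q & unimod_equiv (dilate r P) Q]].

Definition Gorenstein_simplex d (P : set 'rV[R]_d) : Prop :=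
  simplex P /\ Gorenstein P.

End Polytopes.

(* The k-th standard unit vector of R^d, numbered from 1 as usual: e 1, ...,
   e d. *)
Definition e (R : realType) (d k : nat) : 'rV[R]_d :=
  \row_(j < d) (j.+1 == k)%:R.
Arguments e {R d} k.

(* Main.v *)
Require Import Defs.
From HB Require Import structures.
From mathcomp Require Import all_boot all_order all_algebra.
From mathcomp Require Import boolp classical_sets reals topology normedtype convex.
From mathcomp Require Import perm interval_inference ring lra.
Import Order.TTheory GRing.Theory Num.Theory.
Import numFieldNormedType.Exports.
Local Open Scope classical_set_scope.
Local Open Scope ring_scope.

(** Let [v_0, ..., v_5] be the vertices of the simplex and let
    [lambda_0, ..., lambda_5] be its barycentric coordinates. Some dilate [r P]
    is reflexive about a lattice point [p]. The facets of a reflexive polytope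
    lie at lattice distance 1 from its interior point, that is, the dual has
    lattice vertices; so the barycentric coordinates [beta_i] of [p],
    normalised to have sum [r], generate the groups of values of the linear
    parts of the [lambda_i] on the lattice ([Gorenstein_slope]). As
    [lambda_i (v_i) - lambda_i (v_j) = 1] is such a value, [beta_i = 1 / k_i]
    with [k_i] a positive integer, the lattice height of [v_i] over the
    opposite facet. If [k_i = 1] the simplex is a lattice pyramid with apex
    [v_i] ([lattice_pyramid_height1]), hence every [beta_i] is at most [1/2].
    Degree 3 means codegree 3, so [r >= 3] because [r P] has the interior lattice
    point [p]. Six numbers at most [1/2] with sum at least 3 are all equal to
    [1/2] ([Gorenstein_half]).

    So the matrix [H] with rows [(1, v_i)] has a half-integral inverse, and
    [v_0 + ... + v_5 = 2 p]. The lattice is then determined by the binary code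
    of the [c] in [F_2^6] with [c H = 0], which consists of even words and
    contains the all-one word. A word of weight 2 in it is a pair of vertices
    that agree modulo 2, and a word of weight 4 is the complement of such a
    pair; thus the code is known from the pattern of coincidences among the
    vertices modulo 2, and two simplices with the same pattern are unimodularly
    equivalent ([same_pattern_unimodular]).

    Such a pattern is a partition of six points; because the vertices sum to
    zero modulo 2, two disjoint coinciding pairs force the remaining two points
    to coincide. This leaves the partitions 1+1+1+1+1+1, 2+1+1+1+1, 3+1+1+1,
    2+2+2, 4+2 and 6 ([zero_sum_pattern]), one for each of the six simplices. *)

Set Implicit Arguments.
Unset Strict Implicit.
Unset Printing Implicit Defensive.

Local Notation row_hull V := (conv_hull (range (fun i => row i V))).

(** * Convex hulls *)

Section ConvexHulls.
Variable R : realType.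

Lemma convexP d (A : set 'rV[R]_d) :
  convex_set A <-> forall x y (t : R), A x -> A y -> 0 <= t -> t <= 1 ->
    A (t *: x + (1 - t) *: y).
Proof.
split=> [cA x y t Ax Ay t0 t1|cA].
  by have := cA x y (Itv01 t0 t1); rewrite !inE => /(_ Ax Ay).
move=> x y l /set_mem Ax /set_mem Ay; apply/mem_set.
exact: (cA x y l%:num Ax Ay).
Qed.

Lemma conv_hull_convex d (A : set 'rV[R]_d) x y (t : R) :
  conv_hull A x -> conv_hull A y -> 0 <= t -> t <= 1 ->
  conv_hull A (t *: x + (1 - t) *: y).
Proof.
move=> Ax Ay t0 t1 B BP; have [/convexP cB _] := BP.
by apply: cB t0 t1; [exact: Ax|exact: Ay].
Qed.

Lemma conv_hull_sub d (A B : set 'rV[R]_d) :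
  (forall x y (t : R), B x -> B y -> 0 <= t -> t <= 1 ->
    B (t *: x + (1 - t) *: y)) -> A `<=` B -> conv_hull A `<=` B.
Proof. by move=> /convexP cB AB; apply: smallest_sub. Qed.

Lemma sub_conv_hull d (A : set 'rV[R]_d) : A `<=` conv_hull A.
Proof. exact: sub_smallest. Qed.

Lemma conv_hull_min d (A B : set 'rV[R]_d) :
  A `<=` conv_hull B -> conv_hull A `<=` conv_hull B.
Proof. by apply: conv_hull_sub => x y t; exact: conv_hull_convex. Qed.

(** Taking hulls commutes with affine maps because the image and the preimage
    of a convex set under such a map are both convex. *)
Lemma conv_hull_image d d' (A : set 'rV[R]_d) (U : 'M[R]_(d, d')) (w : 'rV_d') :
  [set x *m U + w | x in conv_hull A] =
  conv_hull [set x *m U + w | x in A].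
Proof.
have affE x y t : (t *: x + (1 - t) *: y) *m U + w =
    t *: (x *m U + w) + (1 - t) *: (y *m U + w).
  rewrite mulmxDl -!scalemxAl !scalerDr addrACA -scalerDl.
  by rewrite [t + _]addrC subrK scale1r.
apply/seteqP; split.
  move=> _ [x Ax <-]; move: x Ax.
  apply: (conv_hull_sub (B := [set x | conv_hull _ (x *m U + w)])).
    by move=> x y t /= Bx By t0 t1; rewrite affE; exact: conv_hull_convex.
  by move=> x Ax; apply: sub_conv_hull; exists x.
apply: conv_hull_sub => [_ _ t [x Ax <-] [y Ay <-] t0 t1|_ [x Ax <-]].
  by exists (t *: x + (1 - t) *: y) => //; exact: conv_hull_convex.
by exists x => //; exact: sub_conv_hull.
Qed.

(** If an extreme point [v] of the hull were not in [A], the hull minus [v]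
    would be a smaller convex set containing [A]. *)
Lemma vertex_conv_hull d (A : set 'rV[R]_d) v : vertex (conv_hull A) v -> A v.
Proof.
move=> [hv ext]; apply: contrapT => nAv.
have: (conv_hull A `\ v) v; last by case=> _; exact.
move: hv; apply: conv_hull_sub => [x y t [hx nx] [hy ny] t0 t1|x Ax].
  split; first exact: (conv_hull_convex hx hy t0 t1).
  move=> /= E; have [t00|tn0] := eqVneq t 0.
    by apply: ny; rewrite -E t00 scale0r add0r subr0 scale1r.
  have [t11|tn1] := eqVneq t 1.
    by apply: nx; rewrite -E t11 subrr scale0r addr0 scale1r.
  have xy : x = y.
    apply: (ext x y t hx hy) => //; first by rewrite lt_def tn0.
    by rewrite lt_def eq_sym tn1.
  apply: nx; rewrite -E -xy -scalerDl.
  by rewrite [t + _]addrC subrK scale1r.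
by split; [exact: sub_conv_hull|move=> /= xv; apply: nAv; rewrite -xv].
Qed.

Lemma conv_hull_range d n (v : 'I_n -> 'rV[R]_d) :
  conv_hull (range v) =
  [set x | exists a : 'rV[R]_n,
     [/\ forall i, 0 <= a 0 i, \sum_i a 0 i = 1 & x = \sum_i a 0 i *: v i]].
Proof.
apply/seteqP; split.
  apply: conv_hull_sub => [_ _ t [a [a0 a1 ->]] [b [b0 b1 ->]] t0 t1|_ [i _ <-]].
    exists (t *: a + (1 - t) *: b); split=> [i||].
    - by rewrite !mxE addr_ge0 // mulr_ge0 ?subr_ge0.
    - under eq_bigr do rewrite !mxE.
      by rewrite big_split /= -!mulr_sumr a1 b1; ring.
    - rewrite !scaler_sumr -big_split; apply: eq_bigr => i _ /=.
      by rewrite !mxE [RHS]scalerDl !scalerA.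
  exists (delta_mx 0 i); split=> [j||].
  - by rewrite mxE ler0n.
  - rewrite (bigD1 i) //= big1 => [|j /negPf ji]; last by rewrite mxE ji andbF.
    by rewrite mxE !eqxx addr0.
  - rewrite (bigD1 i) //= big1 => [|j /negPf ji].
      by rewrite mxE !eqxx addr0 scale1r.
    by rewrite mxE ji andbF scale0r.
move=> _ [a [a0 a1 ->]] B [cB vB].
have vBi i : B (v i) by apply: vB; exists i.
clear vB; elim: n v a a0 a1 vBi => [|n IH] v a a0 a1 vBi.
  by move/eqP: a1; rewrite big_ord0 eq_sym oner_eq0.
move: a1; rewrite !big_ord_recl.
set s := \sum_(i < n) a 0 (lift ord0 i) => a1.
have s0 : 0 <= s by rewrite sumr_ge0.
have [sz|sn] := eqVneq s 0.
  rewrite big1 => [|i _]; last first.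
    move/eqP: sz; rewrite psumr_eq0 // => /allP /(_ i).
    by rewrite mem_index_enum => /(_ isT) /eqP ->; rewrite scale0r.
  by have -> : a 0 ord0 = 1; [rewrite -a1 sz addr0|rewrite scale1r addr0].
have -> : \sum_(i < n) a 0 (lift ord0 i) *: v (lift ord0 i) =
    (1 - a 0 ord0) *: \sum_(i < n) (\row_i (s^-1 * a 0 (lift ord0 i))) 0 i *: v (lift ord0 i).
  rewrite scaler_sumr; apply: eq_bigr => i _; rewrite mxE scalerA; congr (_ *: _).
  have -> : 1 - a 0 ord0 = s by rewrite -a1; ring.
  by rewrite mulrA divff // mul1r.
move/convexP: (cB); apply=> //; last by rewrite -a1 lerDl.
apply: (IH (fun i => v (lift ord0 i))) => [i||i].
- by rewrite mxE mulr_ge0 ?invr_ge0.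
- under eq_bigr do rewrite mxE.
  by rewrite -mulr_sumr mulVf.
- exact: vBi.
Qed.

End ConvexHulls.

(** * Barycentric coordinates of a simplex *)

(** Rows of [homog V] are the vertices lifted to height 1, so that affine
    questions about [V] become linear ones about [homog V]. *)
Definition homog (K : pzRingType) n d (V : 'M[K]_(n, d)) : 'M[K]_(n, 1 + d) :=
  row_mx (const_mx 1) V.

Lemma scalemxE (K : pzRingType) m n (a : K) (A : 'M_(m, n)) i j :
  (a *: A) i j = a * A i j.
Proof. exact: mxE. Qed.

Lemma addmxE (K : pzRingType) m n (A B : 'M[K]_(m, n)) i j :
  (A + B) i j = A i j + B i j.
Proof. exact: mxE. Qed.

Lemma oppmxE (K : pzRingType) m n (A : 'M[K]_(m, n)) i j : (- A) i j = - A i j.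
Proof. exact: mxE. Qed.

Lemma const1_mulmx (K : pzRingType) d (w : 'rV[K]_d) :
  (const_mx 1 : 'M_1) *m w = w.
Proof.
by rewrite (_ : const_mx 1 = 1%:M) ?mul1mx //; apply/matrixP => i j; rewrite !mxE !ord1.
Qed.

Lemma mul_homog (K : pzRingType) m n d (a : 'M[K]_(m, n)) (V : 'M[K]_(n, d)) :
  a *m homog V = row_mx (a *m const_mx 1) (a *m V).
Proof. exact: mul_mx_row. Qed.

Lemma homog_mul_block (K : pzRingType) n d d' (V : 'M[K]_(n, d)) (w : 'rV_d')
    (U : 'M_(d, d')) :
  homog V *m block_mx (1%:M : 'M_1) w 0 U =
  homog (V *m U + const_mx 1 *m w).
Proof.
rewrite /homog mul_row_block mulmx1 mulmx0 addr0; congr row_mx.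
by rewrite addrC.
Qed.

Lemma homog_map (K L : pzRingType) (f : {rmorphism K -> L}) n d (V : 'M[K]_(n, d)) :
  homog (map_mx f V) = map_mx f (homog V).
Proof. by rewrite /homog map_row_mx map_const_mx rmorph1. Qed.

(** For [V] with [d + 1] affinely independent rows, [bary V x] lists the
    barycentric coordinates of [x]; [slope V] is their linear part. Both are
    locked to keep conversion from expanding the inverse matrix into minors. *)
HB.lock Definition bary (R : realType) d (V : 'M[R]_(d.+1, d)) (x : 'rV[R]_d) :
    'rV[R]_(1 + d) :=
  homog x *m invmx (homog V : 'M_(1 + d)).

HB.lock Definition slope (R : realType) d (V : 'M[R]_(d.+1, d)) :
    'M[R]_(d, 1 + d) :=
  dsubmx (invmx (homog V : 'M_(1 + d))).

Section Barycentric.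
Variable R : realType.

Lemma affine_indep_row_free d n (v : 'I_n -> 'rV[R]_d) :
  affine_indep v -> row_free (homog (\matrix_i v i)).
Proof.
move=> iv; apply: inj_row_free => a.
rewrite mul_homog -[RHS](@row_mx0 _ 1 1 d) => /eq_row_mx [a1 av].
apply/rowP => i; rewrite [RHS]mxE.
apply: (iv (fun i => a 0 i)).
  have /matrixP /(_ 0 0) := a1; rewrite !mxE => E; rewrite -[RHS]E.
  by apply: eq_bigr => j _; rewrite mxE mulr1.
rewrite -[RHS]av mulmx_sum_row; apply: eq_bigr => j _.
by rewrite rowK.
Qed.

(** The points [x] with [(1, x)] in the row space of [homog V] form an affine
    set containing the rows of [V]. *)
Lemma full_dim_row_full d n (V : 'M[R]_(n, d)) :
  full_dim (row_hull V) -> row_full (homog V).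
Proof.
move=> fd; have span x : (homog (x : 'rV_d) <= homog V)%MS.
  have : affine_hull (row_hull V) x by rewrite fd.
  have hom x1 y t : homog (t *: x1 + (1 - t) *: y : 'rV[R]_d) =
      t *: homog x1 + (1 - t) *: homog y.
    rewrite /homog !scale_row_mx add_row_mx; congr row_mx.
    by apply/matrixP => i j; rewrite !mxE; ring.
  apply: (smallest_sub (X := [set x : 'rV_d | (homog x <= homog V)%MS])).
    move=> x1 y t /= hx hy; rewrite hom.
    by rewrite addmx_sub ?scalemx_sub.
  apply: conv_hull_sub => [x1 y t /= hx hy _ _|_ [i _ <-]] /=.
    by rewrite hom addmx_sub ?scalemx_sub.
  have -> : homog (row i V) = row i (homog V).
    by rewrite /homog row_row_mx; congr row_mx; apply/rowP => j; rewrite !mxE.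
  exact: row_sub.
(* A vector (t, x) is t (1, 0) + (1, x) - (1, 0). *)
rewrite -sub1mx; apply/row_subP => i; set u := row i _.
rewrite -[u]hsubmxK.
have -> : row_mx (lsubmx u) (rsubmx u) =
   (lsubmx u) 0 0 *: homog (0 : 'rV_d) + (homog (rsubmx u) - homog 0).
  rewrite /homog scale_row_mx opp_row_mx !add_row_mx; congr row_mx.
    by apply/rowP => j; rewrite !mxE !ord1; ring.
  by rewrite scaler0 add0r subr0.
by rewrite addmx_sub ?scalemx_sub // addmx_sub ?eqmx_opp.
Qed.

Section Simplex.
Variables (d : nat) (V : 'M[R]_(d.+1, d)).
Hypothesis hV : (homog V : 'M_(1 + d)) \in unitmx.

Lemma baryE x : bary V x = homog x *m invmx (homog V : 'M_(1 + d)).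
Proof. by rewrite bary.unlock. Qed.

Lemma bary_homog x : bary V x *m homog V = homog x.
Proof. by rewrite baryE mulmxKV. Qed.

Lemma bary_sum x : \sum_i bary V x 0 i = 1.
Proof.
have := bary_homog x; rewrite mul_homog => /eq_row_mx [/matrixP /(_ 0 0)].
rewrite !mxE => <- _; apply: eq_bigr => j _; by rewrite [X in _ * X]mxE mulr1.
Qed.

Lemma baryK x : bary V x *m V = x.
Proof. by have := bary_homog x; rewrite mul_homog => /eq_row_mx []. Qed.

Lemma bary_unique (a : 'rV_(1 + d)) :
  \sum_i a 0 i = 1 -> bary V (a *m V) = a.
Proof.
move=> a1; rewrite baryE; have -> : homog (a *m V) = a *m homog V.
  rewrite mul_homog /homog; congr row_mx; apply/matrixP => i j.
  rewrite [LHS]mxE -[LHS]a1 ord1 mxE.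
  by apply: eq_bigr => k _; rewrite [const_mx _ _ _]mxE mulr1.
exact: mulmxK.
Qed.

Lemma bary_row i : bary V (row i V) = delta_mx 0 i.
Proof.
rewrite rowE bary_unique // (bigD1 i) //= big1 => [|j /negPf ji].
  by rewrite mxE !eqxx addr0.
by rewrite mxE ji andbF.
Qed.

Lemma mem_conv_hull_bary x :
  row_hull V x <-> forall i, 0 <= bary V x 0 i.
Proof.
rewrite conv_hull_range; split=> [[a [a0 a1 ->]] i|b0].
  have -> : \sum_i a 0 i *: row i V = a *m V by rewrite mulmx_sum_row.
  by rewrite bary_unique.
exists (bary V x); split => //; first exact: bary_sum.
by rewrite -[LHS]baryK mulmx_sum_row.
Qed.

Lemma bary_slope x : bary V x = bary V 0 + x *m slope V.
Proof.
rewrite !baryE slope.unlock -[invmx _]vsubmxK /homog !mul_row_col mul0mx addr0.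
by rewrite col_mxKd.
Qed.

Lemma vertex_row i : vertex (row_hull V) (row i V).
Proof.
split; first by apply: sub_conv_hull; exists i.
move=> x y t /mem_conv_hull_bary bx /mem_conv_hull_bary by_ t0 t1 E.
have Eb : delta_mx 0 i = t *: bary V x + (1 - t) *: bary V y.
  by rewrite -bary_row E !(bary_slope (_ + _)) mulmxDl -!scalemxAl
    (bary_slope x) (bary_slope y) !scalerDr addrACA -scalerDl
    [t + _]addrC subrK scale1r.
have top z : (forall j, j != i -> bary V z 0 j = 0) -> bary V z = delta_mx 0 i.
  move=> zj; apply/rowP => j; have [->|ji] := eqVneq j i; last first.
    by rewrite zj // [RHS]mxE (negPf ji) andbF.
  by rewrite [RHS]mxE !eqxx -[RHS](bary_sum z) [RHS](bigD1 i) //= big1 ?addr0.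
have xy j : j != i -> bary V x 0 j = 0 /\ bary V y 0 j = 0.
  move=> ji; move/rowP/(_ j): Eb; rewrite [LHS]mxE [RHS]mxE.
  rewrite ![(_ *: bary _ _) _ _]mxE (negPf ji) andbF /= => /esym/eqP.
  have t1' : 0 < 1 - t by rewrite subr_gt0.
  rewrite paddr_eq0 ?mulr_ge0 ?(ltW t0) ?(ltW t1') //.
  rewrite !mulf_eq0 (gt_eqF t0) (gt_eqF t1') /= => /andP [/eqP -> /eqP ->].
  by [].
rewrite -(baryK x) -(baryK y).
have tx := top x (fun j ji => (xy j ji).1).
have ty := top y (fun j ji => (xy j ji).2).
by rewrite tx ty.
Qed.

End Simplex.

Lemma nbhs_rowP d (Q : set 'rV[R]_d) (p : 'rV[R]_d) :
  nbhs p Q <-> exists2 e : R, 0 < e &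
    forall y : 'rV_d, (forall j, `|y 0 j - p 0 j| < e) -> Q y.
Proof.
split.
  move=> /nbhs_ballP [e /= e0 pQ]; exists e => // y hy; apply: pQ.
  by split => // i j; rewrite ord1 /ball /= distrC.
move=> [e e0 pQ]; apply/nbhs_ballP; exists e => //= y [_ py].
by apply: pQ => j; have := py 0 j; rewrite /ball /= distrC.
Qed.

Lemma nbhs_ray d (Q : set 'rV[R]_d) (p z : 'rV[R]_d) :
  nbhs p Q -> exists2 t : R, 0 < t & Q (p + t *: z).
Proof.
move=> /nbhs_rowP [e e0 pQ].
have B0 : 0 < 1 + \sum_j `|z 0 j| by rewrite ltr_pwDl // sumr_ge0.
exists (e / (1 + \sum_j `|z 0 j|)); first by rewrite divr_gt0.
apply: pQ => j; rewrite !mxE [p 0 j + _]addrC addrK normrM.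
rewrite gtr0_norm ?divr_gt0 // mulrAC ltr_pdivrMr // ltr_pM2l //.
rewrite (bigD1 j) //=.
by have : 0 <= \sum_(i < d | i != j) `|z 0 i| by [rewrite sumr_ge0]; lra.
Qed.

Lemma nbhs_affine d d' (Q : set 'rV[R]_d') (U : 'M[R]_(d, d')) w p :
  nbhs (p *m U + w) Q -> nbhs p [set x | Q (x *m U + w)].
Proof.
move=> /nbhs_rowP [e e0 pQ]; apply/nbhs_rowP.
set B := 1 + \sum_k \sum_j `|U k j|.
have B0 : 0 < B.
  by rewrite ltr_pwDl // sumr_ge0 // => k _; rewrite sumr_ge0.
exists (e / B) => [|y hy]; first by rewrite divr_gt0.
apply: pQ => j; rewrite 2![(_ + w) 0 j]mxE opprD addrACA subrr addr0.
have -> : (y *m U) 0 j - (p *m U) 0 j = \sum_k (y 0 k - p 0 k) * U k j.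
  rewrite !mxE -sumrB; apply: eq_bigr => k _; ring.
apply: (le_lt_trans (ler_norm_sum _ _ _)).
apply: (@le_lt_trans _ _ ((e / B) * \sum_k `|U k j|)).
  rewrite mulr_sumr; apply: ler_sum => k _; rewrite normrM.
  by rewrite ler_wpM2r // ltW.
rewrite mulrAC ltr_pdivrMr // ltr_pM2l // /B.
rewrite exchange_big /= (bigD1 j) //=.
have : 0 <= \sum_(i < d' | i != j) \sum_k `|U k i|.
  by rewrite sumr_ge0 // => k _; rewrite sumr_ge0.
lra.
Qed.

End Barycentric.

(** * The facets of a Gorenstein simplex *)

Section GorensteinSimplices.
Variable R : realType.

Lemma pairing_mulmx d (x y : 'rV[R]_d) :
  \sum_(i < d) x 0 i * y 0 i = (x *m y^T) 0 0.
Proof. by rewrite mxE; apply: eq_bigr => i _; rewrite [y^T _ _]mxE. Qed.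

Lemma conv_eq1 (t p q : R) : 0 < t -> t < 1 -> p <= 1 -> q <= 1 ->
  1 = t * p + (1 - t) * q -> p = 1 /\ q = 1.
Proof.
move=> t0 t1 p1 q1 E.
have t1' : 0 < 1 - t by rewrite subr_gt0.
have /eqP : t * (1 - p) + (1 - t) * (1 - q) = 0.
  by rewrite -[RHS](subrr 1) [X in _ = _ - X]E; ring.
rewrite paddr_eq0 ?mulr_ge0 ?subr_ge0 ?(ltW t0) ?(ltW t1) //.
rewrite !mulf_eq0 (gt_eqF t0) (gt_eqF t1') !subr_eq0 /=.
by move=> /andP [/eqP <- /eqP <-].
Qed.

Section Reflexive.
Variables (d : nat) (W : 'M[R]_(d.+1, d)).
Hypothesis hW : (homog W : 'M_(1 + d)) \in unitmx.
Let Q := row_hull W.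

Lemma bary_slopeE x i :
  bary W x 0 i = bary W 0 0 i + (x *m col i (slope W)) 0 0.
Proof. by rewrite (bary_slope W x) [LHS]mxE !colE mulmxA -colE [X in _ = _ + X]mxE. Qed.

(** If [bary_i(0) = 0], moving from 0 away from the [i]-th vertex leaves [Q] at
    once. *)
Lemma bary_gt0 : nbhs (0 : 'rV[R]_d) Q -> forall i, 0 < bary W 0 0 i.
Proof.
move=> nQ i; have Q0 : Q 0 by exact: nbhs_singleton.
have := (mem_conv_hull_bary hW 0).1 Q0 i; rewrite le_eqVlt => /orP [/eqP b0|//].
have [t t0] := nbhs_ray (- row i W) nQ.
move=> /(mem_conv_hull_bary hW _).1 /(_ i).
have Wi : (row i W *m col i (slope W)) 0 0 = 1.
  have := bary_slopeE (row i W) i; rewrite (bary_row hW) -b0 add0r => <-.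
  by rewrite mxE !eqxx.
rewrite add0r bary_slopeE -b0 add0r.
rewrite -scalemxAl mulNmx scalemxE oppmxE Wi mulrN1 oppr_ge0.
by rewrite leNgt t0.
Qed.

(** The facet of [Q] opposite to its [i]-th vertex is cut out by the point
    [y = - slope_i / bary_i(0)] of the dual, which is a vertex of the dual
    because it pairs to 1 with all other vertices of [Q]. *)
Lemma slope_reflexive : nbhs (0 : 'rV[R]_d) Q -> lattice_polytope (dual Q) ->
  forall i, exists y : 'cV[int]_d,
    col i (slope W) = - bary W 0 0 i *: map_mx intr y.
Proof.
move=> nQ [_ latQ] i; have b0 := bary_gt0 nQ.
set b := bary W 0 0 i; have bi : 0 < b := b0 i.
pose y : 'rV[R]_d := - b^-1 *: (col i (slope W))^T.
have yE x : (x *m y^T) 0 0 = 1 - bary W x 0 i / b.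
  rewrite (bary_slopeE x i) -/b mulrDl divff ?gt_eqF // opprD addrA subrr add0r.
  by rewrite /y linearZ /= trmxK -scalemxAr [LHS]mxE mulNr mulrC.
have Qrow j : Q (row j W) by apply: sub_conv_hull; exists j.
have yrow j : j != i -> (row j W *m y^T) 0 0 = 1.
  move=> ji; rewrite yE (bary_row hW) mxE eq_sym (negPf ji) andbF.
  by rewrite mul0r subr0.
have [|yZ _ yZE] := latQ y.
  split.
    move=> x /(mem_conv_hull_bary hW _).1 /(_ i) bx.
    by rewrite pairing_mulmx yE gerBl divr_ge0 // ltW.
  move=> x1 x2 t dx1 dx2 t0 t1 yx.
  have x12 j : j != i -> (row j W *m (x1 - x2)^T) 0 0 = 0.
    move=> ji; have := dx1 _ (Qrow j); have := dx2 _ (Qrow j).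
    rewrite !pairing_mulmx => q1 p1; have := yrow j ji.
    rewrite yx linearD !linearZ /= mulmxDr -!scalemxAr.
    rewrite addmxE !scalemxE => /esym E.
    rewrite linearB /= mulmxBr addmxE oppmxE.
    by have [-> ->] := conv_eq1 t0 t1 p1 q1 E; rewrite subrr.
  (* 0 is a combination of the vertices with a nonzero coefficient at the i-th,
     so x1 - x2, orthogonal to the others, is orthogonal to that one too. *)
  have x12i : (row i W *m (x1 - x2)^T) 0 0 = 0.
    have /matrixP /(_ 0 0) : bary W 0 *m W *m (x1 - x2)^T = 0.
      by rewrite (baryK hW) mul0mx.
    rewrite [bary W 0 *m W]mulmx_sum_row mulmx_suml summxE (bigD1 i) //= big1 => [|j ji].
      rewrite addr0 -scalemxAl scalemxE [RHS]mxE => /eqP.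
      by rewrite mulf_eq0 gt_eqF //= => /eqP.
    by rewrite -scalemxAl scalemxE x12 // mulr0.
  have Wz : homog W *m col_mx 0 (x1 - x2)^T = 0.
    rewrite mul_row_col mulmx0 add0r; apply/row_matrixP => j.
    rewrite row_mul row0; apply/matrixP => k l; rewrite !ord1 [RHS]mxE.
    by have [->|ji] := eqVneq j i; [exact: x12i|exact: x12].
  have /eqP : col_mx (0 : 'cV_1) (x1 - x2)^T = 0.
    by rewrite -[LHS](mulKmx hW) Wz mulmx0.
  rewrite col_mx_eq0 => /andP [_ /eqP /(congr1 trmx)].
  by rewrite trmxK trmx0 => /eqP; rewrite subr_eq0 => /eqP.
exists yZ^T; rewrite -map_trmx yZE /y linearZ /= trmxK scalerA mulrNN.
by rewrite mulfV ?gt_eqF // scale1r.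
Qed.

End Reflexive.

(** Here [p] is the point of [r P] that the equivalence with a reflexive
    polytope sends to the origin. Since barycentric coordinates are invariant
    under affine maps, [slope_reflexive] transfers to [P], where it says that
    the linear part of the [i]-th coordinate is [beta_i] times an integral
    functional. *)
Lemma Gorenstein_slope d (V : 'M[R]_(d.+1, d)) :
  (homog V : 'M_(1 + d)) \in unitmx ->
  Gorenstein (row_hull V) ->
  exists (r : nat) (beta : 'rV[R]_d.+1) (p : 'rV[int]_d) (h : 'M[int]_(d, d.+1)),
    [/\ (1 <= r)%N /\ \sum_i beta 0 i = r%:R, forall i, 0 < beta 0 i,
      map_mx intr p = beta *m V,
      interior (dilate r (row_hull V)) (map_mx intr p) &
      forall i, col i (slope V) = beta 0 i *: map_mx intr (col i h)].
Proof.
move=> hV [_ _ [r [Q [r1 [_ _ Q0 latQ] [U [w [detU EQ]]]]]]].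
have r0 : r%:R != 0 :> R by rewrite pnatr_eq0 -lt0n.
have uU : U \in unitmx.
  by rewrite unitmxE; case: detU => ->; rewrite ?unitrN1 ?unitr1.
pose UR := map_mx intr U : 'M[R]_d; pose wR := map_mx intr w : 'rV[R]_d.
pose UVR := map_mx intr (invmx U) : 'M[R]_d.
have UUV : UR *m UVR = 1%:M by rewrite -map_mxM mulmxV // map_mx1.
have [uUR _] := mulmx1_unit UUV.
pose B : 'M[R]_(1 + d) := block_mx (1%:M : 'M_1) wR 0 (r%:R *: UR).
have uB : B \in unitmx.
  rewrite unitmxE det_ublock det1 mul1r detZ unitrM unitrX ?unitfE //=.
  by rewrite -unitfE -unitmxE.
pose W : 'M[R]_(d.+1, d) := V *m (r%:R *: UR) + const_mx 1 *m wR.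
have WE : homog W = homog V *m B by rewrite homog_mul_block.
have hW : (homog W : 'M_(1 + d)) \in unitmx by rewrite WE unitmx_mul hV uB.
have EQ0 := EQ.
have {}EQ : Q = row_hull W.
  rewrite EQ.
  have -> : [set x *m UR + wR | x in dilate r (row_hull V)] =
     [set x *m (r%:R *: UR) + wR | x in row_hull V].
    rewrite /dilate; apply/seteqP; split=> [_ [_ [x hx <-] <-]|_ [x hx <-]].
      by exists x => //=; rewrite -scalemxAl -scalemxAr.
    exists (r%:R *: x); first by exists x.
    by rewrite -scalemxAl -scalemxAr.
  rewrite conv_hull_image; congr conv_hull.
  rewrite image_comp; apply: eq_imagel => i _ /=.
  rewrite /W linearD /= !row_mul; congr (_ + _).
  by rewrite row_const const1_mulmx.
have Q0' : nbhs (0 : 'rV[R]_d) Q := Q0.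
rewrite EQ in Q0' latQ.
have b0 := bary_gt0 hW Q0'.
have [y yE] := boolp.choice (slope_reflexive hW Q0' latQ).
have baryVW x : bary V x = bary W (x *m (r%:R *: UR) + wR).
  rewrite [RHS]baryE; apply: (canRL (mulmxK hW)).
  rewrite WE mulmxA (bary_homog hV) homog_mul_block.
  by rewrite const1_mulmx.
have slopeVW : slope V = r%:R *: UR *m slope W.
  apply/row_matrixP => i; rewrite !rowE mulmxA.
  apply: (addrI (bary V 0)); rewrite -bary_slope !baryVW mul0mx add0r.
  by rewrite !(bary_slope W (_ + _)) (bary_slope W wR) mulmxDl addrCA addrC.
pose p := - (w *m invmx U).
have pE : map_mx intr p *m UR + wR = 0.
  rewrite /p map_mxN mulNmx map_mxM -/wR -/UVR -mulmxA.
  by rewrite -map_mxM mulVmx // map_mx1 mulmx1 addNr.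
exists r, (r%:R *: bary W 0), p, (- (U *m \matrix_(k, j) y j k 0)); split.
- split => //; under eq_bigr do rewrite scalemxE.
  by rewrite -mulr_sumr (bary_sum hW) mulr1.
- by move=> i; rewrite scalemxE mulr_gt0 // ltr0n.
- have bp : bary V (r%:R^-1 *: map_mx intr p) = bary W 0.
    rewrite baryVW -scalemxAl -scalemxAr scalerA mulVf // scale1r.
    by rewrite pE.
  rewrite -bp -scalemxAl (baryK hV) scalerA mulfV // scale1r //.
- have : nbhs (map_mx intr p : 'rV[R]_d) [set x | Q (x *m UR + wR)].
    by apply: nbhs_affine; rewrite EQ pE.
  apply: filterS => x /=; rewrite EQ0 => -[z hz /addIr /(congr1 (mulmx^~ UVR))].
  by rewrite -!mulmxA UUV !mulmx1 => <-.
- move=> i; rewrite colE slopeVW -mulmxA -colE yE.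
  rewrite -scalemxAl -scalemxAr scalerA scalemxE mulrN scaleNr -scalerN.
  congr (_ *: _).
  apply/colP => k; rewrite !mxE rmorphN /= rmorph_sum /=; congr (- _).
  by apply: eq_bigr => j _; rewrite rmorphM !mxE.
Qed.

End GorensteinSimplices.

(** * Lattice pyramids *)

(** A column taking the value 1 at an integral vector is, by its Smith normal
    form, a unit times a column of a unimodular matrix. *)
Lemma complete_unimodular d (c : 'cV[int]_(d + 1)) (z : 'rV[int]_(d + 1)) :
  (z *m c) 0 0 = 1 -> exists2 U : 'M[int]_(d + 1), U \in unitmx & rsubmx U = c.
Proof.
move=> zc; have [L uL [R' _ [s _ cE]]] := int_Smith_normal_form c.
have d0 : (0 < d + 1)%N by rewrite addn1.
pose o := Ordinal d0; pose m := rshift d (0 : 'I_1) : 'I_(d + 1).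
pose k := s`_0 * R' 0 0.
have cEk : c = k *: col o L.
  rewrite cE; apply/colP => i; rewrite !mxE big_ord1 !mxE (bigD1 o) //= big1.
    by rewrite !mxE eqxx mulr1n addr0 mulrC /k; ring.
  move=> j jo; rewrite !mxE /=; suff /negPf -> : (j : nat) != 0%N by rewrite mulr0.
  by apply: contra jo => /eqP j0; apply/eqP/val_inj.
have uk : k \is a GRing.unit.
  apply/unitrPr; exists ((z *m col o L) 0 0).
  by rewrite -zc cEk -scalemxAr [RHS]mxE.
exists (k *: xcol o m L).
  by rewrite unitmxZ // xcolE unitmx_mul uL unitmx_perm.
by rewrite cEk; apply/colP => i; rewrite !mxE tpermR.
Qed.

Section Pyramids.
Variable R : realType.

Lemma det_unitmx_int d (U : 'M[int]_d) :
  U \in unitmx -> \det U = 1 \/ \det U = -1.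
Proof. by rewrite unitmxE => /orP [] /eqP ->; [left|right]. Qed.

(** An integral affine functional vanishing at all vertices but one, where it
    is 1, can be taken as the last coordinate of a unimodular coordinate
    change; the exceptional vertex is then the apex of a pyramid over the
    other ones. *)
Lemma lattice_pyramid_height1 n d (V : 'M[int]_(n, d + 1))
    (h : 'cV[int]_(d + 1)) (c : int) (i j0 : 'I_n) :
  let Delta := row_hull (map_mx intr V : 'M[R]_(n, d + 1)) in
  j0 != i -> (forall j, (row j V *m h) 0 0 = c + (j == i)%:R) ->
  full_dim Delta -> lattice_pyramid Delta.
Proof.
move=> Delta j0i hV fdD.
have [U uU Uh] : exists2 U : 'M[int]_(d + 1), U \in unitmx & rsubmx U = h.
  apply: (@complete_unimodular _ _ (row i V - row j0 V)).
  rewrite mulmxBl [LHS]mxE [X in _ + X]mxE !hV eqxx (negPf j0i) addr0.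
  by rewrite [LHS]addrAC subrr add0r.
pose q j : 'rV[int]_d := lsubmx (row j V *m U) - lsubmx (row i V *m U).
pose qR j : 'rV[R]_d := map_mx intr (q j).
pose w : 'rV[int]_(d + 1) := row_mx (- lsubmx (row i V *m U)) (- c%:M).
have VUw j : row j V *m U + w = row_mx (q j) ((j == i)%:R)%:M.
  rewrite -[row j V *m U]hsubmxK add_row_mx -mulmx_rsub Uh; congr row_mx.
  apply/matrixP => k l; rewrite !ord1 [LHS]mxE hV !mxE /= mulr1n.
  by rewrite addrAC subrr add0r.
pose P' := [set x *m map_mx intr U + map_mx intr w | x in Delta].
have P'E : P' = conv_hull (range (fun j => row_mx (qR j) ((j == i)%:R)%:M)).
  rewrite /P' /Delta conv_hull_image image_comp; congr conv_hull.
  apply: eq_imagel => j _ /=.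
  rewrite -map_row -map_mxM -map_mxD VUw map_row_mx; congr row_mx.
  by rewrite map_scalar_mx /=; case: (j == i).
pose Q := conv_hull [set qR j | j in [set j | j != i]].
have qi0 : qR i = 0 by rewrite /qR /q subrr map_mx0.
have PyrQ : Pyr Q = P'.
  rewrite P'E; apply/seteqP; split.
    apply: conv_hull_min.
    move=> _ [[x Qx <-]|->].
      have : [set x *m row_mx 1%:M 0 + 0 | x in Q] (row_mx x 0 : 'rV[R]_(d+1)).
        by exists x => //; rewrite mul_mx_row mulmx1 mulmx0 addr0.
      rewrite conv_hull_image; apply: conv_hull_min.
      move=> _ [_ [j /= ji <-] <-]; apply: sub_conv_hull; exists j => //.
      rewrite (negPf ji) mul_mx_row mulmx1 mulmx0 addr0; congr row_mx.
      by apply/matrixP => k l; rewrite !mxE mul0rn.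
    apply: sub_conv_hull; exists i => //; rewrite qi0 eqxx; congr row_mx.
  apply: conv_hull_min.
  move=> _ [j _ <-]; apply: sub_conv_hull.
  have [->|ji] := eqVneq j i.
    by right; rewrite /= qi0; congr row_mx.
  left; exists (qR j); first by apply: sub_conv_hull; exists j.
  congr row_mx; apply/matrixP => k l; rewrite !mxE.
  by rewrite mul0rn.
pose UR := map_mx intr U : 'M[R]_(d + 1).
pose UVR := map_mx intr (invmx U) : 'M[R]_(d + 1).
have UUV : UR *m UVR = 1%:M by rewrite -map_mxM mulmxV // map_mx1.
exists d, Q, P'; split.
- split; last first.
    by move=> v vQ; have [j _ <-] := vertex_conv_hull vQ; exists (q j).
  exists [seq qR j | j <- enum 'I_n & j != i]; congr conv_hull.
  apply/seteqP; split => [_ [j /= ji <-]|x /= /mapP [j]].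
    by apply/mapP; exists j => //; rewrite mem_filter ji mem_enum.
  by rewrite mem_filter => /andP [ji _] ->; exists j.
- have full x : affine_hull Q x.
    move=> A [aA QA].
    have Aq : A (qR j0) by apply: QA; apply: sub_conv_hull; exists j0.
    (* Project along the edge from the apex to the vertex q_j0 of the base: this
       affine map onto the base space sends every vertex into Q. *)
    pose T : 'M[R]_(d + 1, d) := col_mx 1%:M (qR j0).
    pose f (y : 'rV[R]_(d + 1)) := (y *m UR + map_mx intr w) *m T.
    have fE s t y : f (t *: s + (1 - t) *: y) = t *: f s + (1 - t) *: f y.
      rewrite /f !mulmxDl -!scalemxAl !scalerDr addrACA -scalerDl.
      by rewrite [t + _]addrC subrK scale1r.
    have Af y : A (f y).
      have : affine_hull Delta y by rewrite fdD.
      apply: (smallest_sub (X := [set y | A (f y)])).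
        by move=> s y' t /= As Ay; rewrite fE; exact: aA.
      apply: conv_hull_sub => [s y' t /= As Ay _ _|_ [j _ <-] /=].
        by rewrite fE; exact: aA.
      rewrite /f -map_row -map_mxM -map_mxD VUw map_row_mx mul_row_col mulmx1.
      have [->|ji] := eqVneq j i.
        by rewrite -/(qR i) qi0 add0r map_scalar_mx mul1mx.
      rewrite map_scalar_mx mul_scalar_mx scale0r addr0.
      by apply: QA; apply: sub_conv_hull; exists j.
    have := Af ((row_mx x 0 - map_mx intr w) *m UVR).
    by rewrite /f -mulmxA (mulmx1C UUV) mulmx1 subrK mul_row_col mulmx1 mul0mx addr0.
  by apply/seteqP; split=> // x _; exact: full.
- rewrite -PyrQ; exact: iterated_Pyr_once.
- exists (invmx U), (- w *m invmx U); split.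
    by apply: det_unitmx_int; rewrite unitmx_inv.
  rewrite map_mxM map_mxN /P' image_comp -[LHS]image_id.
  apply: eq_imagel => x _ /=; rewrite -/UVR -/UR mulNmx mulmxDl -addrA subrr.
  by rewrite addr0 -mulmxA UUV mulmx1.
Qed.

End Pyramids.

(** * Half-integrality *)

Section HalfIntegrality.
Variable R : realType.

Lemma lattice_simplex_matrix d (P : set 'rV[R]_d) :
  simplex P -> full_dim P -> lattice_polytope P ->
  exists V : 'M[int]_(d.+1, d),
    P = row_hull (map_mx intr V) /\
    (homog (map_mx intr V : 'M[R]_(d.+1, d)) : 'M_(1 + d)) \in unitmx.
Proof.
move=> [n [v [iv PE]]] fd [_ latP].
have {}PE : P = row_hull (\matrix_i v i).
  by rewrite PE; congr conv_hull; apply: eq_imagel => i _; rewrite rowK.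
have free := affine_indep_row_free iv.
have full : row_full (homog (\matrix_i v i)) by apply: full_dim_row_full; rewrite -PE.
have nd : n = d by apply/eq_add_S; rewrite -(eqP free) (eqP full).
subst n; set V := \matrix_i v i in free full PE.
have hV : (homog V : 'M_(1 + d)) \in unitmx by rewrite -row_free_unit.
have /boolp.choice [u uE] : forall i, exists z : 'rV[int]_d, map_mx intr z = row i V.
  by move=> i; have := latP (row i V); rewrite PE => /(_ (vertex_row hV i)) [z _ <-]; exists z.
have VE : V = map_mx intr (\matrix_i u i).
  by apply/row_matrixP => i; rewrite -map_row rowK uE.
by exists (\matrix_i u i); rewrite -VE.
Qed.

Lemma intr_matrix_inj m n : injective (map_mx intr : 'M[int]_(m, n) -> 'M[R]_(m, n)).
Proof.
move=> A B /matrixP AB; apply/matrixP => i j.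
by have := AB i j; rewrite !mxE => /intr_inj.
Qed.

(** The numbers [beta_i] of [Gorenstein_slope] are unit fractions [1 / k],
    where [k] is the lattice height of the [i]-th vertex over the opposite
    facet; [k = 1] makes the simplex a lattice pyramid. So [beta_i <= 1/2],
    while the sum of the [beta_i] is at least the codegree; when the codegree
    is at least half the number of vertices, only [beta_i = 1/2] is left. *)
Lemma Gorenstein_half d (V : 'M[int]_((d + 1).+1, d + 1)) (c : nat) :
  let Delta := row_hull (map_mx intr V : 'M[R]_(_, d + 1)) in
  (homog (map_mx intr V : 'M[R]_(_, d + 1)) : 'M_(1 + (d + 1))) \in unitmx ->
  full_dim Delta -> Gorenstein Delta -> ~ lattice_pyramid Delta ->
  is_codeg Delta c -> ((d + 1).+1 <= c * 2)%N ->
  exists (N : 'M[int]_(1 + (d + 1))) (p : 'rV[int]_(d + 1)),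
    homog V *m N = 2%:M /\ \sum_i row i V = p + p.
Proof.
move=> Delta hV fd GD npyr [_ cmin] dc.
have [r [beta [p [h [[r1 sbeta] beta0 pE pint slopeE]]]]] := Gorenstein_slope hV GD.
set VR := map_mx intr V : 'M[R]_(_, d + 1).
have ijE i j k : beta 0 k * (((row i V - row j V) *m col k h) 0 0)%:~R =
    (k == i)%:R - (k == j)%:R.
  have E m : (row m VR *m col k (slope VR)) 0 0 = (k == m)%:R - bary VR 0 0 k.
    have := bary_slopeE VR (row m VR) k; rewrite (bary_row hV) mxE eqxx /= => ->.
    by rewrite addrC addKr.
  have -> : (k == i)%:R - (k == j)%:R =
     ((row i VR - row j VR) *m col k (slope VR)) 0 0.
    by rewrite mulmxBl addmxE oppmxE !E; ring.
  rewrite slopeE -scalemxAr scalemxE; congr (_ * _).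
  by rewrite -!map_row -map_mxB -map_mxM [RHS]mxE.
(* The r-th dilate has the interior lattice point p. *)
have cr : (c <= r)%N.
  by apply: cmin; split => //; exists (map_mx intr p); split => //; exists p.
have half i : beta 0 i <= 2^-1.
  have j0i := neq_lift i (rshift d (0 : 'I_1)).
  set j0 := lift i _ in j0i.
  have := ijE i j0 i; rewrite eqxx (negPf j0i) subr0.
  set k : int := _ 0 0 => bk.
  have k0 : 0 < k by rewrite -(ltr0z R) -(pmulr_rgt0 _ (beta0 i)) bk.
  have [k1|k2] : k = 1 \/ 2 <= k.
    have [|k1] := eqVneq k 1; [by left|right].
    by rewrite -[2]/(1 + 1) lezD1 lt_neqAle eq_sym k1 -gtz0_ge1.
  - exfalso; apply: npyr.
    apply: (lattice_pyramid_height1 (h := col i h)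
       (c := (row j0 V *m col i h) 0 0) (i := i) (j0 := j0)) => //.
      by rewrite eq_sym.
    move=> j; have := ijE j j0 i; rewrite (negPf j0i) subr0.
    move: bk; rewrite k1 mulr1 => ->; rewrite mul1r mulmxBl => jE.
    have {}jE : ((row j V *m col i h - row j0 V *m col i h) 0 0) = (i == j)%:R.
      by apply: (@intr_inj R); rewrite jE rmorph_nat.
    by rewrite eq_sym -jE addmxE oppmxE addrC subrK.
  - have k2R : 2 <= k%:~R :> R by rewrite (ler_int R 2 k).
    rewrite -[leLHS]mulr1 -[X in _ * X](mulfV (x := k%:~R)) ?gt_eqF ?ltr0z //.
    by rewrite mulrA bk mul1r lef_pV2 // posrE; lra.
have {half} betaE i : beta 0 i = 2^-1.
  have s0 : \sum_i (2^-1 - beta 0 i) = 0.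
    apply/eqP; rewrite eq_le sumr_ge0 ?andbT => [|k _]; last by rewrite subr_ge0.
    rewrite big_split /= sumrN sbeta sumr_const card_ord subr_le0 -[leLHS]mulr_natr.
    rewrite ler_pdivrMl // -natrM ler_nat.
    by apply: (leq_trans dc); rewrite mulnC leq_mul2l cr orbT.
  move/eqP: s0; rewrite psumr_eq0 => [/allP /(_ i)|k _]; last by rewrite subr_ge0.
  by rewrite mem_index_enum => /(_ isT); rewrite subr_eq0 => /eqP.
(* The slopes are h / 2, and t / 2 is the list of barycentric coordinates of 0,
   computed from those of a vertex. *)
pose j0 : 'I_(d + 1).+1 := ord0.
pose t : 'rV[int]_(d + 1).+1 := 2 *: delta_mx 0 j0 - row j0 V *m h.
exists (col_mx t h), p; split.
  apply/row_matrixP => i; rewrite row_mul /homog row_row_mx mul_row_col.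
  rewrite row_const; apply/rowP => k; rewrite addmxE.
  rewrite const1_mulmx.
  have := ijE i j0 k; rewrite betaE => /(congr1 ( *%R 2)).
  rewrite mulVKf ?pnatr_eq0 // => E.
  have {}E : ((row i V - row j0 V) *m col k h) 0 0 =
      2 * ((k == i)%:R - (k == j0)%:R).
    by apply: (@intr_inj R); rewrite E !(rmorphM, rmorphB, rmorph_nat).
  move: E; rewrite colE mulmxA -colE [LHS]mxE mulmxBl addmxE oppmxE => E.
  rewrite addmxE oppmxE scalemxE.
  rewrite -addrA [- _ + _]addrC E !mxE eqxx /= (eq_sym i k) -mulr_natr; ring.
apply: intr_matrix_inj; rewrite map_mxD pE raddf_sum /=.
have -> : beta = const_mx 2^-1 by apply/rowP => i; rewrite betaE mxE.
rewrite mulmx_sum_row -big_split /=; apply: eq_bigr => i _.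
have h2 : 2^-1 + 2^-1 = 1 :> R by lra.
by rewrite mxE -scalerDl h2 scale1r map_row.
Qed.

End HalfIntegrality.

(** * Simplices with the same vertex pattern modulo 2 *)

Lemma scalemx_inj m n (a : int) : a != 0 ->
  injective (fun A : 'M[int]_(m, n) => a *: A).
Proof.
move=> a0 A B /matrixP AB; apply/matrixP => i j.
by apply: (mulfI a0); rewrite -!scalemxE AB.
Qed.

Lemma mulmx_scalarC n (A B : 'M[int]_n) (a : int) :
  a != 0 -> A *m B = a%:M -> B *m A = a%:M.
Proof.
move=> a0 AB; have detA : \det A != 0.
  have : \det (A *m B) != 0 by rewrite AB det_scalar expf_neq0.
  by rewrite det_mulmx mulf_eq0 negb_or => /andP [].
have /(congr1 (mulmx (\adj A))) : A *m (B *m A - a%:M) = 0.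
  by rewrite mulmxBr mulmxA AB scalar_mxC subrr.
rewrite mulmxA mul_adj_mx mulmx0 mul_scalar_mx -[RHS](scaler0 _ (\det A)).
by move/(scalemx_inj detA)/eqP; rewrite subr_eq0 => /eqP.
Qed.

Lemma F2_eq0_or1 (x : 'F_2) : x = (x != 0)%:R.
Proof. by case: x => [[|[|//]] ?]; apply/val_inj. Qed.

Lemma addF2 m n (x : 'M['F_2]_(m, n)) : x + x = 0.
Proof. by apply/matrixP => i j; rewrite !mxE; exact: (addrr_pchar2 (pchar_Fp _)). Qed.

(** The height coordinate of [homog W] detects the parity of a word, the other
    coordinates detect the sum of the vertices in its support. *)
Lemma mulmx_homog_F2 n d (c : 'rV['F_2]_n) (W : 'M['F_2]_(n, d)) :
  let S := [set i | c 0 i != 0]%SET in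
  c *m homog W = 0 <-> ~~ odd #|S| /\ \sum_(i in S) row i W = 0.
Proof.
move=> S; have sumS (T : lmodType 'F_2) (F : 'I_n -> T) :
    \sum_i c 0 i *: F i = \sum_(i in S) F i.
  rewrite [RHS]big_mkcond; apply: eq_bigr => i _; rewrite inE.
  by rewrite {1}[c 0 i]F2_eq0_or1; case: ifP; rewrite ?scale1r ?scale0r.
have cW : c *m W = \sum_(i in S) row i W by rewrite mulmx_sum_row sumS.
have c1 : (c *m (const_mx 1 : 'cV_n)) = ((odd #|S|)%:R)%:M.
  apply/matrixP => i j; rewrite !ord1 !mxE /= mulr1n.
  have -> : \sum_j0 c 0 j0 * (const_mx 1 : 'cV_n) j0 0 = \sum_(i in S) (1 : ('F_2)^o).
    by rewrite -sumS; apply: eq_bigr => k _; rewrite mxE.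
  rewrite sumr_const -[in LHS](odd_double_half #|S|) mulrnDr -muln2 mulnC mulrnA.
  by rewrite (_ : 1 *+ 2 = 0 :> ('F_2)^o) ?mul0rn ?addr0 //; apply/val_inj.
rewrite mul_homog c1 cW; split=> [|[/negPf -> ->]].
  move/eqP; rewrite row_mx_eq0 => /andP [/eqP o /eqP ->]; split=> //.
  by apply/negP => oS; move/matrixP/(_ 0 0): o; rewrite oS !mxE.
by rewrite raddf0 row_mx0.
Qed.

(** An even subset of six points is empty, a pair, the complement of a pair, or
    everything; so which even subsets of a zero-sum family sum to zero is
    decided by which pairs of members are equal. *)
Lemma sum_even_set_eq0 (T T' : zmodType) (f : 'I_6 -> T) (g : 'I_6 -> T')
    (S : {set 'I_6}) :
  (forall x : T, x + x = 0) -> (forall x : T', x + x = 0) ->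
  \sum_i f i = 0 -> \sum_i g i = 0 -> (forall i j, f i = f j -> g i = g j) ->
  ~~ odd #|S| -> \sum_(i in S) f i = 0 -> \sum_(i in S) g i = 0.
Proof.
move=> T2 T2' f0 g0 fg.
have pair (A : {set 'I_6}) : #|A| = 2 -> \sum_(i in A) f i = 0 -> \sum_(i in A) g i = 0.
  move=> /eqP /cards2P [x [y [xy ->]]]; rewrite !big_setU1 ?inE //= !big_set1.
  move/eqP; rewrite addr_eq0 => /eqP fxy.
  have -> : g x = g y by apply: fg; rewrite fxy; apply/eqP; rewrite eq_sym -addr_eq0 T2.
  exact: T2'.
have compl (U : zmodType) (F : 'I_6 -> U) (A : {set 'I_6}) : \sum_i F i = 0 ->
    \sum_(i in ~: A) F i = 0 -> \sum_(i in A) F i = 0.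
  rewrite (bigID (mem A)) /= => + F0.
  have -> : \sum_(i | i \notin A) F i = \sum_(i in ~: A) F i.
    by apply: eq_bigl => i; rewrite inE.
  by rewrite F0 addr0.
have := cardsC S; rewrite card_ord.
case E : #|S| => [|[|[|[|[|[|[|k]]]]]]] //= SC _ fS.
- by move/eqP: E; rewrite cards_eq0 => /eqP ->; rewrite big_set0.
- exact: pair.
- apply: (compl) => //; apply: pair; first by case: SC.
  by apply: (compl) => //; rewrite finset.setCK.
- apply: (compl) => //; have /eqP : #|~: S| = 0%N by case: SC.
  by rewrite cards_eq0 => /eqP ->; rewrite big_set0.
Qed.

Local Notation mod2 := (map_mx (intr : int -> 'F_2)).

Lemma mod2_eq0 m n (A : 'M[int]_(m, n)) : mod2 A = 0 -> exists B, A = 2 *: B.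
Proof.
move=> A0; exists (map_mx (fun x => x %/ 2)%Z A); apply/matrixP => i j.
rewrite !mxE mulrC divzK //.
by have /matrixP /(_ i j) := A0; rewrite !mxE (dvdz_pcharf (pchar_Fp (isT : prime 2))) => ->.
Qed.

(** The second condition says that the all-one word lies in the code. *)
Definition half_integral (V : 'M[int]_(6, 5)) : Prop :=
  (exists N : 'M[int]_6, homog V *m N = 2%:M) /\ \sum_i row i (mod2 V) = 0.

(** The entries of [L] are arbitrary labels of the classes modulo 2. *)
Definition has_pattern (V : 'M[int]_(6, 5)) (L : seq nat) : Prop :=
  forall i j, (row i (mod2 V) == row j (mod2 V)) = (nth 0%N L i == nth 0%N L j).

(** The rows of [N] modulo 2 are words of the code of [V], because
    [N *m homog V = 2], hence also of the code of [V']. *)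
Lemma same_pattern_quotient (V V' : 'M[int]_(6, 5)) (N : 'M[int]_6) :
  homog V *m N = 2%:M ->
  \sum_i row i (mod2 V) = 0 -> \sum_i row i (mod2 V') = 0 ->
  (forall i j, row i (mod2 V) = row j (mod2 V) ->
    row i (mod2 V') = row j (mod2 V')) ->
  exists G : 'M[int]_6, N *m homog V' = 2 *: G.
Proof.
move=> VN V0 V0' pat; apply: mod2_eq0; apply/row_matrixP => i.
have NV : N *m homog V = 2%:M by exact: mulmx_scalarC VN.
rewrite map_mxM row_mul row0 -homog_map.
apply/mulmx_homog_F2.
have /mulmx_homog_F2 [oS S0] : row i (mod2 N) *m homog (mod2 V) = 0.
  rewrite homog_map -row_mul -map_mxM NV map_scalar_mx /=.
  by rewrite (_ : 2%:~R = 0 :> 'F_2) ?raddf0 ?row0 //; apply/val_inj.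
split=> //; apply: sum_even_set_eq0 pat oS S0 => //; exact: addF2.
Qed.

(** Two half-integral simplices whose vertices coincide modulo 2 in the same
    pattern have, modulo 2, the same relations between their vertices. That
    makes the affine map taking one to the other, and its inverse, integral. *)
Lemma same_pattern_unimodular (V V' : 'M[int]_(6, 5)) :
  half_integral V -> half_integral V' ->
  (forall i j, row i (mod2 V) = row j (mod2 V) <->
    row i (mod2 V') = row j (mod2 V')) ->
  exists (U : 'M[int]_5) (w : 'rV[int]_5),
    U \in unitmx /\ V' = V *m U + const_mx 1 *m w.
Proof.
move=> [[N VN] V0] [[N' VN'] V0'] pat.
have [G GE] := same_pattern_quotient VN V0 V0' (fun i j => (pat i j).1).
have [G' GE'] := same_pattern_quotient VN' V0' V0 (fun i j => (pat i j).2).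
have NV : N *m homog V = 2%:M by exact: mulmx_scalarC VN.
have two_inj m n (A B : 'M[int]_(m, n)) : 2%:M *m A = 2%:M *m B -> A = B.
  by rewrite !mul_scalar_mx; exact: scalemx_inj.
(* 4 G G' = N (homog V') N' (homog V) = 2 N (homog V) = 4 *)
have GG' : G *m G' = 1%:M.
  apply: (two_inj); apply: two_inj; rewrite mulmx1 !mul_scalar_mx scalemxAl.
  rewrite -GE [_ *: (_ *m _)]scalemxAr -GE' mulmxA -[N *m _ *m _]mulmxA VN'.
  by rewrite -mulmxA mul_scalar_mx -scalemxAr NV -mul_scalar_mx.
have [uG _] := mulmx1_unit GG'.
have VG : homog V *m G = homog V'.
  apply: two_inj; rewrite !mul_scalar_mx scalemxAr -GE mulmxA VN.
  by rewrite mul_scalar_mx.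
(* G fixes the height, so it is the matrix of an affine map. *)
pose G1 : 'M[int]_(1 + 5) := G.
have G1E : lsubmx G1 = col_mx 1%:M 0.
  apply: two_inj; rewrite -NV -!mulmxA; congr (_ *m _).
  rewrite mul_row_col mulmx1 mulmx0 addr0.
  have := congr1 (fun A : 'M_(6, 1 + 5) => lsubmx A) VG; rewrite -mulmx_lsub => ->.
  by rewrite row_mxKl.
pose w := usubmx (rsubmx G1); pose U := dsubmx (rsubmx G1).
have G1B : G1 = block_mx 1%:M w 0 U.
  by rewrite block_mxEh -G1E vsubmxK hsubmxK.
exists U, w; split.
  move: uG; rewrite -/G1 G1B !unitmxE.
  by rewrite (det_ublock (1%:M : 'M_1)) det1 mul1r.
have : homog (V *m U + const_mx 1 *m w) = homog V'.
  by rewrite -homog_mul_block -G1B.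
by move=> /eq_row_mx [_ ->].
Qed.

(** * The possible patterns *)

(** A normal form for the coincidences among the entries of [t]: each entry is
    labelled by the position where it first occurs. *)
Definition index_pattern (T : eqType) (t : seq T) : seq nat :=
  [seq index x t | x <- t].

Lemma index_patternE (T : eqType) (x0 : T) (t : seq T) i j :
  (i < size t)%N -> (j < size t)%N ->
  (nth 0%N (index_pattern t) i == nth 0%N (index_pattern t) j) =
  (nth x0 t i == nth x0 t j).
Proof.
move=> it jt; rewrite !(nth_map x0) //; apply/eqP/eqP => [E|-> //].
by rewrite -(nth_index x0 (mem_nth x0 it)) E nth_index ?mem_nth.
Qed.

(** As first occurrences come no later than occurrences, every index pattern of
    length [n] is among these [n!] sequences. *)
Fixpoint staircase_seqs n : seq (seq nat) :=
  if n is m.+1 then [seq rcons s x | s <- staircase_seqs m, x <- iota 0 m.+1]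
  else [:: [::]].

Lemma mem_staircase_seqs (s : seq nat) :
  (forall i, (i < size s)%N -> (nth 0 s i <= i)%N) -> s \in staircase_seqs (size s).
Proof.
elim/last_ind: s => [|s x IH] hs; first by rewrite inE.
rewrite size_rcons [staircase_seqs _]/(allpairs_dep _ _ _).
apply/allpairsPdep; exists s, x; split=> //.
  apply: IH => i is_; have := hs i; rewrite size_rcons nth_rcons is_; apply.
  exact: ltnW.
have := hs (size s); rewrite size_rcons nth_rcons ltnn eqxx => /(_ (ltnSn _)) xs.
by rewrite mem_iota.
Qed.

Lemma index_nth_le (T : eqType) (x0 : T) (t : seq T) i :
  (i < size t)%N -> (index (nth x0 t i) t <= i)%N.
Proof.
move=> it; rewrite leqNgt; apply/negP => /(before_find x0).
by rewrite /= eqxx.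
Qed.

(** In a zero-sum family of six elements of a group of exponent 2, two disjoint
    pairs of equal elements cancel and leave two elements that are equal. *)
Definition paired (s : seq nat) : bool :=
  all (fun p => let u k := nth 0%N s (nth 0%N p k) in
    [&& u 0 == u 1 & u 2 == u 3] ==> (u 4 == u 5)) (permutations (iota 0 6)).

(** Reordering a sequence this way brings each class together and larger
    classes first, so that its index pattern depends only on the sizes of the
    classes. *)
Definition size_order (s : seq nat) : seq nat :=
  let size_of i := count_mem (nth 0%N s i) s in
  sort (fun i j => (size_of j < size_of i)%N ||
    ((size_of i == size_of j) && (nth 0%N s i <= nth 0%N s j)%N)) (iota 0 (size s)).

Definition patterns : seq (seq nat) :=
  [:: [:: 0; 1; 2; 3; 4; 5]; [:: 0; 0; 2; 3; 4; 5]; [:: 0; 0; 0; 3; 4; 5];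
      [:: 0; 0; 2; 2; 4; 4]; [:: 0; 0; 0; 0; 4; 4]; [:: 0; 0; 0; 0; 0; 0]]%N.

Lemma paired_pattern (s : seq nat) : s \in staircase_seqs 6 -> paired s ->
  index_pattern [seq nth 0%N s i | i <- size_order s] \in patterns.
Proof.
have: all (fun s => paired s ==>
    (index_pattern [seq nth 0%N s i | i <- size_order s] \in patterns)) (staircase_seqs 6).
  by vm_compute.
by move=> /allP H /H /implyP.
Qed.

(** The index pattern of [f] is [paired], and the claim then rests on an
    inspection of the [paired] staircase sequences. *)
Lemma zero_sum_pattern (T : zmodType) (f : 'I_6 -> T) :
  (forall x : T, x + x = 0) -> \sum_i f i = 0 ->
  exists2 tau : 'I_6 -> 'I_6, injective tau & exists2 L, L \in patterns &
    forall i j, (f (tau i) == f (tau j)) = (nth 0%N L i == nth 0%N L j).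
Proof.
move=> T2 f0; pose g k := f (inord k).
pose t := mkseq g 6; pose s := index_pattern t.
have st : size t = 6%N by rewrite size_mkseq.
have ss : size s = 6%N by rewrite size_map st.
have sE i j : (i < 6)%N -> (j < 6)%N ->
    (nth 0%N s i == nth 0%N s j) = (g i == g j).
  by move=> i6 j6; rewrite (index_patternE 0) ?st // !nth_mkseq.
have sI : s \in staircase_seqs 6.
  rewrite -ss; apply: mem_staircase_seqs => i; rewrite ss => i6.
  by rewrite (nth_map 0) ?st // index_nth_le ?st.
have ps : paired s.
  apply/allP => p; rewrite mem_permutations => pp; apply/implyP.
  have p6 : forall x, x \in p -> (x < 6)%N.
    by move=> x; rewrite (perm_mem pp) mem_iota.
  have : \sum_(x <- p) g x = 0.
    rewrite (perm_big _ pp) -[RHS]f0.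
    rewrite -[iota _ _]/(index_iota 0 6) big_mkord; apply: eq_bigr => i _.
    by rewrite /g inord_val.
  have := perm_size pp; case: p pp p6 => [|a [|b [|c [|d [|x [|y [|]]]]]]] //= _ p6 _.
  rewrite !sE ?p6 ?inE ?eqxx ?orbT //.
  rewrite !big_cons big_nil addr0 => S /andP [/eqP ab /eqP cd].
  move: S; rewrite ab cd addrA T2 add0r addrA T2 add0r => /eqP.
  by rewrite addr_eq0 => /eqP ->; rewrite eq_sym -addr_eq0 T2.
have := paired_pattern sI ps; set o := size_order s; set L := index_pattern _ => LP.
have po : perm_eq o (iota 0 6).
  by rewrite /o /size_order ss perm_sort.
have so : size o = 6%N by rewrite (perm_size po).
have o6 i : (i < 6)%N -> (nth 0%N o i < 6)%N.
  by move=> i6; have := mem_nth 0%N (s := o) (n := i); rewrite so (perm_mem po) mem_iota; apply.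
exists (fun i => inord (nth 0%N o i)).
  move=> i j /(congr1 val); rewrite /= !inordK ?o6 // => /eqP.
  rewrite nth_uniq ?so ?(perm_uniq po) ?iota_uniq // => /eqP; exact: val_inj.
exists L => // i j.
rewrite (index_patternE 0%N) ?size_map ?so // !(nth_map 0%N) ?so //.
by rewrite sE ?o6.
Qed.

(** * The six simplices *)

Definition entry (A : seq (seq int)) i j : int := (nth [::] A i)`_j.

Definition seqs_mx m n (A : seq (seq int)) : 'M[int]_(m, n) :=
  \matrix_(i, j) entry A i j.

(** A sum that evaluates, unlike [\sum], whose definition is locked. *)
Definition sum_upto n (F : nat -> int) : int := foldr +%R 0 [seq F j | j <- iota 0 n].

Lemma sum_uptoE n F : sum_upto n F = \sum_(j < n) F j.
Proof.
rewrite /sum_upto -(big_mkord predT) /index_iota subn0.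
by rewrite -(big_map F predT id) foldrE.
Qed.

(** The vertices of the six simplices, grouped by their class modulo 2, each
    list between the pattern of these classes and a matrix [N] witnessing
    half-integrality: twice the inverse of the homogeneous vertex matrix. *)
Definition models : seq (seq nat * seq (seq int) * seq (seq int)) :=
  [:: ([:: 0; 1; 2; 3; 4; 5]%N,
       [:: [:: 0; 0; 0; 0; 0]; [:: 1; 0; 0; 0; 0]; [:: 0; 1; 0; 0; 0];
           [:: 0; 0; 1; 0; 0]; [:: 0; 0; 0; 1; 0]; [:: 1; 1; 1; 1; 2]],
       [:: [:: 2; 0; 0; 0; 0; 0]; [:: -2; 2; 0; 0; 0; 0]; [:: -2; 0; 2; 0; 0; 0];
           [:: -2; 0; 0; 2; 0; 0]; [:: -2; 0; 0; 0; 2; 0]; [:: 3; -1; -1; -1; -1; 1]]);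
      ([:: 0; 0; 2; 3; 4; 5]%N,
       [:: [:: 0; 0; 0; 0; 0]; [:: 0; 0; 0; 2; 0]; [:: 1; 0; 0; 0; 0];
           [:: 0; 1; 0; 0; 0]; [:: 0; 0; 1; 0; 0]; [:: 1; 1; 1; 0; 2]],
       [:: [:: 2; 0; 0; 0; 0; 0]; [:: -2; 0; 2; 0; 0; 0]; [:: -2; 0; 0; 2; 0; 0];
           [:: -2; 0; 0; 0; 2; 0]; [:: -1; 1; 0; 0; 0; 0]; [:: 2; 0; -1; -1; -1; 1]]);
      ([:: 0; 0; 0; 3; 4; 5]%N,
       [:: [:: 0; 0; 0; 0; 0]; [:: 0; 0; 2; 0; 0]; [:: 0; 0; 0; 2; 0];
           [:: 1; 0; 0; 0; 0]; [:: 0; 1; 0; 0; 0]; [:: 1; 1; 0; 0; 2]],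
       [:: [:: 2; 0; 0; 0; 0; 0]; [:: -2; 0; 0; 2; 0; 0]; [:: -2; 0; 0; 0; 2; 0];
           [:: -1; 1; 0; 0; 0; 0]; [:: -1; 0; 1; 0; 0; 0]; [:: 1; 0; 0; -1; -1; 1]]);
      ([:: 0; 0; 2; 2; 4; 4]%N,
       [:: [:: 0; 0; 0; 0; 0]; [:: 0; 0; 2; 0; 0]; [:: 1; 0; 0; 0; 0];
           [:: 1; 0; 0; 0; 2]; [:: 0; 1; 0; 0; 0]; [:: 0; 1; 0; 2; 0]],
       [:: [:: 2; 0; 0; 0; 0; 0]; [:: -2; 0; 2; 0; 0; 0]; [:: -2; 0; 0; 0; 2; 0];
           [:: -1; 1; 0; 0; 0; 0]; [:: 0; 0; 0; 0; -1; 1]; [:: 0; 0; -1; 1; 0; 0]]);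
      ([:: 0; 0; 0; 0; 4; 4]%N,
       [:: [:: 0; 0; 0; 0; 0]; [:: 0; 2; 0; 0; 0]; [:: 0; 0; 2; 0; 0];
           [:: 0; 0; 0; 2; 0]; [:: 1; 0; 0; 0; 0]; [:: 1; 0; 0; 0; 2]],
       [:: [:: 2; 0; 0; 0; 0; 0]; [:: -2; 0; 0; 0; 2; 0]; [:: -1; 1; 0; 0; 0; 0];
           [:: -1; 0; 1; 0; 0; 0]; [:: -1; 0; 0; 1; 0; 0]; [:: 0; 0; 0; 0; -1; 1]]);
      ([:: 0; 0; 0; 0; 0; 0]%N,
       [:: [:: 0; 0; 0; 0; 0]; [:: 2; 0; 0; 0; 0]; [:: 0; 2; 0; 0; 0];
           [:: 0; 0; 2; 0; 0]; [:: 0; 0; 0; 2; 0]; [:: 0; 0; 0; 0; 2]],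
       [:: [:: 2; 0; 0; 0; 0; 0]; [:: -1; 1; 0; 0; 0; 0]; [:: -1; 0; 1; 0; 0; 0];
           [:: -1; 0; 0; 1; 0; 0]; [:: -1; 0; 0; 0; 1; 0]; [:: -1; 0; 0; 0; 0; 1]])].

Definition model_spec (L : seq nat) (A N : seq (seq int)) : bool :=
  [&& size A == 6%N,
      all (fun i => all (fun k =>
        sum_upto 6 (fun j => entry [seq 1 :: r | r <- A] i j * entry N j k) ==
        2 *+ (i == k)) (iota 0 6)) (iota 0 6),
      all (fun j => sum_upto 6 (fun i => entry A i j) == 2) (iota 0 5) &
      all (fun i => all (fun j =>
        (nth 0%N L i == nth 0%N L j) ==
        all (fun k => ~~ odd `|(entry A i k - entry A j k)%R|%N) (iota 0 5))
        (iota 0 6)) (iota 0 6)].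

Lemma models_spec : all (fun m => model_spec m.1.1 m.1.2 m.2) models.
Proof. by vm_compute. Qed.

Lemma intr_F2_eq0 (z : int) : (z%:~R == 0 :> 'F_2) = ~~ odd `|z|%N.
Proof. by rewrite -(dvdz_pcharf (pchar_Fp (isT : prime 2))) dvdzE /= dvdn2. Qed.

Lemma model_specP L A N : model_spec L A N ->
  [/\ size A = 6%N, half_integral (seqs_mx 6 5 A) & has_pattern (seqs_mx 6 5 A) L].
Proof.
move=> /and4P [/eqP sA /allP HN /allP H2 /allP HL].
have io n (i : 'I_n) : (i : nat) \in iota 0 n by rewrite mem_iota ltn_ord.
split=> //; last first.
  move=> i j; have /allP /(_ _ (io _ j)) /eqP -> := HL _ (io _ i).
  apply/eqP/allP => [/rowP E k|E].
    rewrite mem_iota /= => k5; have := E (Ordinal k5); rewrite !mxE => /eqP.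
    by rewrite -subr_eq0 -rmorphB intr_F2_eq0.
  apply/rowP => k; have := E _ (io _ k); rewrite -intr_F2_eq0 rmorphB subr_eq0.
  by rewrite !mxE => /eqP.
split.
  exists (seqs_mx 6 6 N).
  have -> : homog (seqs_mx 6 5 A) = seqs_mx 6 (1 + 5) [seq 1 :: r | r <- A].
    apply/matrixP => i j; rewrite !mxE /entry (nth_map [::]) ?sA //.
    by case: splitP => k ->; rewrite ?(ord1 k) !mxE.
  apply/matrixP => i k; have /allP /(_ _ (io _ k)) /eqP := HN _ (io _ i).
  rewrite sum_uptoE !mxE => <-.
  by apply: eq_bigr => j _; rewrite !mxE.
apply/rowP => j; rewrite summxE !mxE.
have /eqP := H2 _ (io _ j); rewrite sum_uptoE => E.
transitivity ((\sum_(i < 6) entry A i j)%:~R : 'F_2); last by rewrite E; apply/val_inj.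
by rewrite rmorph_sum; apply: eq_bigr => i _; rewrite !mxE.
Qed.

Section Classification.
Variable R : realType.

Definition lattice_hull (V : 'M[int]_(6, 5)) : set 'rV[R]_5 :=
  row_hull (map_mx intr V).

Lemma lattice_hull_perm (V : 'M[int]_(6, 5)) (tau : 'I_6 -> 'I_6) :
  injective tau -> lattice_hull (rowsub tau V) = lattice_hull V.
Proof.
move=> inj; rewrite /lattice_hull; congr conv_hull.
have rowE i : row i (map_mx intr (rowsub tau V)) =
    row (tau i) (map_mx intr V) :> 'rV[R]_5 by apply/rowP => j; rewrite !mxE.
apply/seteqP; split=> _ [i _ <-]; first by rewrite rowE; exists (tau i).
by exists (invF inj i) => //; rewrite rowE f_invF.
Qed.

Lemma half_integral_perm (V : 'M[int]_(6, 5)) (tau : 'I_6 -> 'I_6) :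
  injective tau -> half_integral V -> half_integral (rowsub tau V).
Proof.
move=> inj [[N VN] V0]; split.
  exists (colsub tau N).
  have -> : homog (rowsub tau V) = rowsub tau (homog V).
    by apply/matrixP => i j; rewrite !mxE; case: splitP => k _; rewrite !mxE.
  rewrite mul_rowsub_mx mulmx_colsub VN.
  by apply/matrixP => i j; rewrite !mxE (inj_eq inj).
rewrite -[RHS]V0 [RHS](reindex_inj inj); apply: eq_bigr => i _.
by apply/rowP => j; rewrite !mxE.
Qed.

Lemma same_pattern_equiv (V V' : 'M[int]_(6, 5)) L :
  half_integral V -> half_integral V' -> has_pattern V L -> has_pattern V' L ->
  unimod_equiv (lattice_hull V) (lattice_hull V').
Proof.
move=> hV hV' pV pV'.
have [i j|U [w [uU ->]]] := same_pattern_unimodular hV hV'.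
  by split=> /eqP; rewrite ?pV ?pV' => E; apply/eqP; rewrite ?pV ?pV'.
exists U, w; split; first exact: det_unitmx_int.
rewrite /lattice_hull conv_hull_image image_comp; congr conv_hull.
apply: eq_imagel => i _ /=.
rewrite -!map_row linearD /= !row_mul row_const const1_mulmx.
by rewrite map_mxD map_mxM.
Qed.

Definition vec (r : seq int) : 'rV[R]_5 := \row_j (r`_j)%:~R.

Lemma lattice_hull_seqs (A : seq (seq int)) : size A = 6%N ->
  lattice_hull (seqs_mx 6 5 A) = conv_hull [set vec r | r in [set` A]].
Proof.
move=> sA; have rowA i : row i (map_mx intr (seqs_mx 6 5 A)) = vec (nth [::] A i).
  by apply/rowP => j; rewrite !mxE.
rewrite /lattice_hull; congr conv_hull; apply/seteqP; split.
  by move=> _ [i _ <-]; exists (nth [::] A i); rewrite ?rowA //= mem_nth ?sA.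
move=> _ [r /= rA <-]; have r6 : (index r A < 6)%N by rewrite -sA index_mem.
by exists (Ordinal r6); rewrite // rowA /= nth_index.
Qed.

Lemma half_integral_model (V : 'M[int]_(6, 5)) : half_integral V ->
  exists2 m, m \in models &
    unimod_equiv (lattice_hull V) (conv_hull [set vec r | r in [set` m.1.2]]).
Proof.
move=> hV; have [tau inj [L LP pV]] :=
  zero_sum_pattern (f := fun i => row i (mod2 V)) (fun x => addF2 x) hV.2.
have /mapP [m mM Lm] : L \in [seq m.1.1 | m <- models] by [].
have [sA hA pA] := model_specP (allP models_spec m mM).
exists m => //; rewrite -lattice_hull_seqs // -(lattice_hull_perm V inj).
apply: same_pattern_equiv hA _ pA; first exact: half_integral_perm.
move=> i j; rewrite -Lm -pV; congr (_ == _); apply/rowP => k; by rewrite !mxE.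
Qed.

Lemma image_seq6 (T T' : eqType) (f : T -> T') a b c d x y :
  [set f r | r in [set` [:: a; b; c; d; x; y]]] =
  [set f a; f b; f c; f d; f x; f y].
Proof.
apply/seteqP; split=> [_ [r /= rA <-]|z /=].
  move: rA; rewrite !inE => /or4P [/eqP|/eqP|/eqP|/or3P [] /eqP] ->; tauto.
by move=> [[[[[]|]|]|]|] ->; [exists a|exists b|exists c|exists d|exists x|exists y];
  rewrite //= !inE eqxx ?orbT.
Qed.

Lemma vecE (a b c d x : int) : vec [:: a; b; c; d; x] =
  a%:~R *: e 1 + b%:~R *: e 2 + c%:~R *: e 3 + d%:~R *: e 4 + x%:~R *: e 5.
Proof. by apply/rowP => -[[|[|[|[|[|//]]]]] ?]; rewrite !mxE /=; ring. Qed.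

Lemma unimod_equiv_eq_hull d (P A B : set 'rV[R]_d) :
  unimod_equiv P (conv_hull A) -> (forall z, A z <-> B z) ->
  unimod_equiv P (conv_hull B).
Proof. by move=> PA AB; have <- : A = B by apply/seteqP; split=> z /AB. Qed.

End Classification.

Theorem theorem4p4 (R : realType) (Delta : set 'rV[R]_5)
    (Delta_dim : full_dim Delta)
    (Delta_Gorenstein : Gorenstein_simplex Delta)
    (Delta_deg : is_deg Delta 3)
    (Delta_not_pyramid : ~ lattice_pyramid Delta) :
  unimod_equiv Delta (conv_hull
    [set 0; e 1; e 2; e 3; e 4; e 1 + e 2 + e 3 + e 4 + 2 *: e 5]) \/
  unimod_equiv Delta (conv_hull
    [set 0; e 1; e 2; e 3; 2 *: e 4; e 1 + e 2 + e 3 + 2 *: e 5]) \/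
  unimod_equiv Delta (conv_hull
    [set 0; e 1; e 2; 2 *: e 3; 2 *: e 4; e 1 + e 2 + 2 *: e 5]) \/
  unimod_equiv Delta (conv_hull
    [set 0; e 1; e 2; 2 *: e 3; e 2 + 2 *: e 4; e 1 + 2 *: e 5]) \/
  unimod_equiv Delta (conv_hull
    [set 0; e 1; 2 *: e 2; 2 *: e 3; 2 *: e 4; e 1 + 2 *: e 5]) \/
  unimod_equiv Delta (conv_hull
    [set 0; 2 *: e 1; 2 *: e 2; 2 *: e 3; 2 *: e 4; 2 *: e 5]).
Proof.
have [splx Gor] := Delta_Gorenstein; have [latD _ _] := Gor.
have [c [codeg c3]] := Delta_deg.
have [V [DE hV]] := lattice_simplex_matrix splx Delta_dim latD.
rewrite DE in Delta_dim Gor Delta_not_pyramid codeg.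
(* Degree 3 in dimension 5 means codegree 3, half the number of vertices. *)
have c6 : (6 <= c * 2)%N by case: c c3 {codeg} => [|[|[|[|]]]].
have [N [p [VN Vp]]] :=
  @Gorenstein_half R 4 V c hV Delta_dim Gor Delta_not_pyramid codeg c6.
have half : half_integral V.
  split; first by exists N.
  transitivity (mod2 (\sum_i row i V)); last by rewrite Vp map_mxD addF2.
  by rewrite raddf_sum; apply: eq_bigr => i _ /=; rewrite map_row.
have {DE} -> : Delta = lattice_hull V by [].
have [m mM] := half_integral_model R half.
move: mM; rewrite !inE => /or4P [/eqP|/eqP|/eqP|/or3P [] /eqP] -> /=;
  rewrite image_seq6 !vecE;
  rewrite !(rmorph0, rmorph1, rmorph_nat, scale0r, scale1r, add0r, addr0) => equiv.
- by left.
- by right; left; apply: (unimod_equiv_eq_hull equiv) => z /=; tauto.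
- by do 2 right; left; apply: (unimod_equiv_eq_hull equiv) => z /=; tauto.
- by do 3 right; left; apply: (unimod_equiv_eq_hull equiv) => z /=; tauto.
- by do 4 right; left; apply: (unimod_equiv_eq_hull equiv) => z /=; tauto.
- by do 5 right.
Qed.
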